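(* For any distribution $D$ on $\mathcal X\times\{-1,1\}$, any self-complemented set $\mathcal H$ of voters $\mathcal X\to[-1,1]$, any prior $P$ on $\mathcal H$, any convex function $\mathcal D:[0,1]\times[0,1]\to\mathbb R$ with $\mathcal D(q,p)=\mathcal D(1-q,1-p)$ for all $q,p$, any $m'>0$ and any $\delta\in(0,1]$, with probability at least $1-\delta$ over $S\sim D^m$, for all posteriors $Q$ aligned on $P$, $$\mathcal D\big(R_S(G_Q),R_D(G_Q)\big)\ \le\ \frac1{m'}\ln\Big(\frac1\delta\,\mathbb E_{S\sim D^m}\mathbb E_{f\sim P}e^{m'\mathcal D(\mathcal L_{\ell,S}(f),\mathcal L_{\ell,D}(f))}\Big).$$
   Context: $\mathcal L_\ell(a,y)=\tfrac12(1-ya)$; $\mathcal L_{\ell,D'}(f)=\mathbb E_{(x,y)\sim D'}\mathcal L_\ell(f(x),y)$ and $R_{D'}(G_Q)=\mathbb E_{f\sim Q}\mathcal L_{\ell,D'}(f)$, for $D'=D$ or $D'=S$ (uniform on the sample). $\mathcal H$ is self-complemented if there is a bijection $c:\mathcal H\to\mathcal H$ with $c(f)=-f$ for all $f$. A distribution $Q$ on $\mathcal H$ is aligned on $P$ if $Q(f)+Q(c(f))=P(f)+P(c(f))$ for all $f\in\mathcal H$ (where $Q(f),P(f)$ are probability masses, or densities with respect to a common reference measure invariant under $c$). $P$ is independent of $S$. *)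

(* Defs.v *)
From HB Require Import structures.
From mathcomp Require Import all_boot all_order all_algebra.
From mathcomp Require Import all_classical all_reals all_analysis.
Set Implicit Arguments. Unset Strict Implicit. Unset Printing Implicit Defensive.
Import Order.TTheory GRing.Theory Num.Theory.
Local Open Scope classical_set_scope.
Local Open Scope ring_scope.

Section PACBayesDefs.
Variable R : realType.

(* labels in {-1,1} are encoded by bool: true |-> 1, false |-> -1 *)
Definition lab (y : bool) : R := if y then 1 else -1.

Definition lin_loss (a : R) (y : bool) : R := 2^-1 * (1 - lab y * a).

Definition emp_loss {X : Type} (m : nat) (S : 'I_m -> (X * bool)%type) (f : X -> R) : R :=
  (m%:R)^-1 * \sum_(i < m) lin_loss (f (S i).1) (S i).2.

Definition true_loss {d} {X : measurableType d}
  (D : probability (X * bool)%type R) (f : X -> R) : R :=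
  Rintegral D setT (fun z => lin_loss (f z.1) z.2).

(* Gibbs risk R(G_Q) = E_{f~Q} L(f), Q given by a density q w.r.t. mu *)
Definition gibbs_risk {dH} {H : measurableType dH}
  (mu : {measure set H -> \bar R}) (q : H -> R) (L : H -> R) : R :=
  Rintegral mu setT (fun f => q f * L f).

Definition is_density {dH} {H : measurableType dH}
  (mu : {measure set H -> \bar R}) (q : H -> R) : Prop :=
  measurable_fun setT q /\ (forall f, 0 <= q f) /\
  (\int[mu]_f (q f)%:E = 1)%E.

Definition aligned {H : Type} (c : H -> H) (q p : H -> R) : Prop :=
  forall f, q f + q (c f) = p f + p (c f).

Definition in01 (x : R) := 0 <= x <= 1.
Definition convex_on_square (Dfun : R -> R -> R) : Prop :=
  forall q1 p1 q2 p2 t, in01 q1 -> in01 p1 -> in01 q2 -> in01 p2 -> in01 t ->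
    Dfun (t * q1 + (1 - t) * q2) (t * p1 + (1 - t) * p2)
      <= t * Dfun q1 p1 + (1 - t) * Dfun q2 p2.

Definition mutually_independent {d} {Omega : measurableType d}
  (Pr : probability Omega R) {dY} {Y : measurableType dY} (m : nat)
  (Z : 'I_m -> Omega -> Y) : Prop :=
  forall (B : 'I_m -> set Y), (forall i, measurable (B i)) ->
    Pr (\bigcap_(i in [set: 'I_m]) (Z i @^-1` B i))
    = (\prod_(i < m) Pr (Z i @^-1` B i))%E.

Definition has_law {d} {Omega : measurableType d}
  (Pr : probability Omega R) {dY} {Y : measurableType dY}
  (V : Omega -> Y) (D : probability Y R) : Prop :=
  forall B, measurable B -> Pr (V @^-1` B) = D B.

End PACBayesDefs.

(* Main.v *)
(* A convex comparator is bounded and upper semicontinuous on the square, hence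
   Borel, so that Y(S) = E_{f~P} exp(m' D(L_S(f), L_D(f))) is measurable and
   Markov's inequality gives Y(S) <= E[Y] / delta with probability at least
   1 - delta.  For such S, Jensen's inequality bounds D(R_S(G_Q), R_D(G_Q)) by
   E_{f~Q} D(L_S(f), L_D(f)).  Complementing f turns both losses L into 1 - L,
   so by the symmetry of D the integrand is c-invariant and, Q being aligned
   on P, its Q- and P-expectations agree: this is a change of measure without
   any KL term.  Jensen's inequality for exp concludes. *)
Require Import Defs.
From HB Require Import structures.
From mathcomp Require Import all_boot all_order all_algebra.
From mathcomp Require Import all_classical all_reals all_analysis.
From mathcomp Require Import measurable_realfun ring lra.
Import Order.TTheory GRing.Theory Num.Theory.
Local Open Scope classical_set_scope.
Local Open Scope ring_scope.

Lemma measurable_gt_set (R : realType) (d : measure_display) (T : measurableType d)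
    (u : T -> R) (r : R) : measurable_fun setT u -> measurable [set s | r < u s].
Proof.
move=> mu; have := mu measurableT _ (measurable_itv `]r, +oo[).
rewrite setTI; congr measurable.
by apply/seteqP; split => s /=; rewrite in_itv/= andbT.
Qed.

(** * Convex functions on the unit square: upper bound, semicontinuity, measurability *)

Section ConvexSquare.
Variables (R : realType) (F : R -> R -> R).
Hypothesis F_convex : convex_on_square F.

Lemma in01_conv (x y t : R) :
  in01 x -> in01 y -> in01 t -> in01 (t * x + (1 - t) * y).
Proof.
rewrite /in01 => /andP[x0 x1] /andP[y0 y1] /andP[t0 t1].
by apply/andP; split; nra.
Qed.

(** Convexity along the edges [x = 0] and [x = 1], then in the [x] direction, bounds every value by
    a mixture of the four corner values, hence by the sum of their absolute values. *)
Lemma convex_square_ubound : exists M, forall x y, in01 x -> in01 y -> F x y <= M.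
Proof.
have i0 : in01 (0 : R) by rewrite /in01 lexx ler01.
have i1 : in01 (1 : R) by rewrite /in01 lexx ler01.
exists (`|F 0 0| + `|F 0 1| + `|F 1 0| + `|F 1 1|) => x y hx hy.
have /andP[x0 x1] := hx; have /andP[y0 y1] := hy.
have := F_convex _ _ _ _ _ i1 hy i0 hy hx.
rewrite (_ : x * 1 + (1 - x) * 0 = x); last by ring.
rewrite (_ : x * y + (1 - x) * y = y); last by ring.
have := F_convex _ _ _ _ _ i0 i1 i0 i0 hy.
rewrite (_ : y * 0 + (1 - y) * 0 = 0); last by ring.
rewrite (_ : y * 1 + (1 - y) * 0 = y); last by ring.
have := F_convex _ _ _ _ _ i1 i1 i1 i0 hy.
rewrite (_ : y * 1 + (1 - y) * 1 = 1); last by ring.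
rewrite (_ : y * 1 + (1 - y) * 0 = y); last by ring.
have := ler_norm (F 0 0); have := ler_norm (F 0 1).
have := ler_norm (F 1 0); have := ler_norm (F 1 1).
have := normr_ge0 (F 0 0); have := normr_ge0 (F 0 1).
have := normr_ge0 (F 1 0); have := normr_ge0 (F 1 1).
set a := `|F 0 0|; set b := `|F 0 1|; set c := `|F 1 0|; set d := `|F 1 1|.
move=> d0 c0 b0 a0 hd hc hb ha h1 h2 h3.
have h4 : F 1 y <= a + b + c + d by nra.
have h5 : F 0 y <= a + b + c + d by nra.
nra.
Qed.

(** Stretching [x - x0] by [1 / l] about [x0] exhibits [x] as a mixture giving weight [1 - l] to
    [x0]. For an interior [x0] the stretch is limited by the distance to the nearer endpoint; at an
    endpoint [x - x0] already points inward, so only the length 1 of the interval limits it. *)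
Lemma in01_extend (x0 : R) : in01 x0 -> exists2 eta, 0 < eta &
  forall l x, 0 < l -> in01 x -> `|x - x0| < l * eta -> in01 (x0 + (x - x0) / l).
Proof.
move=> /andP[h0 h1].
exists (if (x0 == 0) || (x0 == 1) then 1 else Num.min x0 (1 - x0)).
  case: eqVneq => //= n0; case: eqVneq => //= n1.
  by rewrite lt_min subr_gt0 lt0r n0 h0 lt_neqAle n1.
move=> l x l0 /andP[hx0 hx1].
have lN : l != 0 by rewrite gt_eqF.
have E : x - x0 = l * ((x - x0) / l) by field.
rewrite {1}E normrM (gtr0_norm l0) ltr_pM2l// => {E}.
have hr : 0 <= x - x0 -> 0 <= (x - x0) / l by move=> ?; rewrite divr_ge0// ltW.
have hl : x - x0 <= 0 -> (x - x0) / l <= 0.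
  by move=> ?; rewrite pmulr_lle0// invr_gt0.
move: hr hl; set e := (x - x0) / l => hr hl; rewrite ltr_norml => /andP[].
case: eqVneq => /= [x00|n0]; last case: eqVneq => /= [x01|n1].
- by move=> e1 e2; rewrite /in01; have := hr; rewrite x00 subr0 => /(_ hx0) ?; lra.
- move=> e1 e2; rewrite /in01.
  by have := hl; rewrite x01 => /(_ ltac:(lra)) ?; lra.
- move=> e1 e2.
  have ex : e < x0 by apply: lt_le_trans e2 _; rewrite ge_min lexx.
  have ex' : e < 1 - x0 by apply: lt_le_trans e2 _; rewrite ge_min lexx orbT.
  have exN : - x0 < e by apply: le_lt_trans e1; rewrite lerN2 ge_min lexx.
  by rewrite /in01; lra.
Qed.

(* A convex function on a polytope is upper semicontinuous (Gale-Klee-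
   Rockafellar): a point close to [z0] is a mixture of [z0], with weight close
   to 1, and of another point of the square. *)
Lemma convex_square_usc (x0 y0 t : R) : in01 x0 -> in01 y0 -> F x0 y0 < t ->
  exists2 e, 0 < e & forall x y, in01 x -> in01 y ->
    `|x - x0| < e -> `|y - y0| < e -> F x y < t.
Proof.
move=> hx0 hy0 Ft; have [M FM] := convex_square_ubound.
have [ex ex0 hex] := in01_extend _ hx0.
have [ey ey0 hey] := in01_extend _ hy0.
pose g := t - F x0 y0; pose k := `|M - F x0 y0|.
have g0 : 0 < g by rewrite /g subr_gt0.
have k0 : 0 <= k := normr_ge0 _.
have hk : M - F x0 y0 <= k := ler_norm _.
(* This weight makes the excess [l * (M - F x0 y0)] at most [g / 2], below the available gap [g].
   The summand [g] in the denominator keeps it positive when [k = 0] and gives [l <= 1]. *)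
pose l := g / (2 * (g + k)).
have gk : 0 < g + k by lra.
have l0 : 0 < l by rewrite /l divr_gt0// mulr_gt0.
have lE : l * (g + k) = g / 2 by rewrite /l; field; rewrite gt_eqF.
have l1 : l <= 1 by nra.
exists (l * Num.min ex ey); first by rewrite mulr_gt0// lt_min ex0.
move=> x y hx hy dx dy.
have hx' : in01 (x0 + (x - x0) / l).
  by apply: hex => //; apply: lt_le_trans dx _; rewrite ler_pM2l// ge_min lexx.
have hy' : in01 (y0 + (y - y0) / l).
  by apply: hey => //; apply: lt_le_trans dy _; rewrite ler_pM2l// ge_min lexx orbT.
have il : in01 l by rewrite /in01 l1 ltW.
have := F_convex _ _ _ _ _ hx' hy' hx0 hy0 il.
have lN : l != 0 by rewrite gt_eqF.
rewrite (_ : l * _ + _ = x); last by field.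
rewrite (_ : l * _ + _ = y); last by field.
have := FM _ _ hx' hy'; set z := F (_ + _) _ => zM.
rewrite /g in lE g0 l0 *; nra.
Qed.

(** By upper semicontinuity the set [F < t] is relatively open in the square, so it is covered by
    countably many rational boxes on which [F < t]; preimages of boxes are measurable. *)
Lemma measurable_convex_square (d : measure_display) (T : measurableType d)
    (u v : T -> R) : measurable_fun setT u -> measurable_fun setT v ->
  (forall s, in01 (u s)) -> (forall s, in01 (v s)) ->
  measurable_fun setT (fun s => F (u s) (v s)).
Proof.
move=> mu mv hu hv.
apply: (measurability _ (RGenCInfty.measurableE R)) => //= _ [_ [t ->] <-].
rewrite setTI.
pose box (z : rat * rat * (rat * rat)) := [set s | ratr z.1.1 < u s] `&`
  [set s | u s < ratr z.1.2] `&` ([set s | ratr z.2.1 < v s] `&`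
  [set s | v s < ratr z.2.2]).
pose good (z : rat * rat * (rat * rat)) := forall x y, in01 x -> in01 y ->
  ratr z.1.1 < x -> x < ratr z.1.2 -> ratr z.2.1 < y -> y < ratr z.2.2 -> F x y < t.
(* Boxes containing a point of the square with [F >= t] are replaced by the empty set, so that the
   union runs over the whole countable type of rational quadruples. *)
pose G z := if `[< good z >] then box z else set0.
have -> : (fun s => F (u s) (v s)) @^-1` `[t, +oo[ = ~` (\bigcup_z G z).
  apply/seteqP; split => s /=; rewrite in_itv/= andbT.
    move=> tF [z _]; rewrite /G; case: asboolP => //= gz [[] /= ? ? [] /= ? ?].
    by have : F (u s) (v s) < t; [exact: gz|rewrite ltNge tF].
  move=> nG; rewrite leNgt; apply/negP => Ft; apply: nG.
  have [e e0 he] := convex_square_usc _ _ _ (hu s) (hv s) Ft.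
  have rat_between (x y : R) : x < y -> exists r : rat, x < ratr r < y.
    move=> xy; have [r] := @rat_in_itvoo R _ _ xy.
    by rewrite in_itv/= => rxy; exists r.
  have [a /andP[a1 a2]] := rat_between (u s - e) (u s) ltac:(lra).
  have [b /andP[b1 b2]] := rat_between (u s) (u s + e) ltac:(lra).
  have [c /andP[c1 c2]] := rat_between (v s - e) (v s) ltac:(lra).
  have [f /andP[f1 f2]] := rat_between (v s) (v s + e) ltac:(lra).
  exists (a, b, (c, f)) => //; rewrite /G; case: asboolP => //= ng.
  exfalso; apply: ng => x y hx hy /= ? ? ? ?; apply: he => //;
    by rewrite ltr_norml; lra.
apply: measurableC; apply: countable_bigcupT_measurable => // z.
have mlt (r : R) (w : T -> R) : measurable_fun setT w -> measurable [set s | w s < r].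
  move=> mw; have := measurable_gt_set _ _ _ (fun s => - w s) (- r).
  rewrite (_ : [set s | - r < - w s] = [set s | w s < r]); last first.
    by apply/seteqP; split => s /=; rewrite ltrN2.
  by apply; exact: measurable_funN.
rewrite /G; case: asboolP => // _.
by do 2?apply: measurableI; apply: measurable_gt_set || apply: mlt.
Qed.

End ConvexSquare.

(** * Supporting lines and planes *)

(** One extension step of Hahn-Banach: points with [y s < b] bound the slope from below, points with
    [b < y t] bound it from above, and the last hypothesis, once denominators are cleared, says that
    each lower bound is below each upper bound. The supremum of the lower bounds then works. *)
Lemma supporting_slope (R : realType) (T : Type) (P : set T) (y g : T -> R) (b : R) :
  (exists2 s, P s & y s < b) -> (exists2 t, P t & b < y t) ->
  (forall t, P t -> y t = b -> 0 <= g t) ->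
  (forall s t, P s -> P t -> y s < b -> b < y t ->
     0 <= (y t - b) * g s + (b - y s) * g t) ->
  exists beta, forall t, P t -> beta * (y t - b) <= g t.
Proof.
move=> [s0 Ps0 ys0] [t0 Pt0 yt0] gb gst.
pose A := [set r | exists2 s, P s /\ y s < b & r = - g s / (b - y s)].
have ubA t : P t -> b < y t -> ubound A (g t / (y t - b)).
  move=> Pt yt _ [s [Ps ys] ->].
  have := gst _ _ Ps Pt ys yt.
  by rewrite ler_pdivrMr ?subr_gt0// mulrAC ler_pdivlMr ?subr_gt0//; lra.
have supA : has_sup A by split; [exists (- g s0 / (b - y s0)), s0|exists (g t0 / (y t0 - b)); apply: ubA].
exists (sup A) => t Pt; have [yt|yt|yt] := ltgtP (y t) b.
- have /(sup_upper_bound supA) : A (- g t / (b - y t)) by exists t.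
  by rewrite ler_pdivrMr ?subr_gt0//; lra.
- rewrite -ler_pdivlMr ?subr_gt0//; apply: ge_sup; last exact: ubA.
  by case: supA.
- by rewrite yt subrr mulr0; apply: gb.
Qed.

Section Supporting.
Variable R : realType.

Lemma convex_supporting_line (phi : R -> R) (a : R) :
  (forall x y t, in01 x -> in01 y -> in01 t ->
     phi (t * x + (1 - t) * y) <= t * phi x + (1 - t) * phi y) ->
  0 < a < 1 ->
  exists alpha, forall x, in01 x -> phi a + alpha * (x - a) <= phi x.
Proof.
move=> cphi /andP[a0 a1].
have i0 : in01 (0 : R) by rewrite /in01 lexx ler01.
have i1 : in01 (1 : R) by rewrite /in01 lexx ler01.
have [|||x y hx hy xa ay|al hal] :=
  @supporting_slope R R (@in01 R) id (fun x => phi x - phi a) a.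
- by exists 0.
- by exists 1.
- by move=> t _ ->; rewrite subrr.
- rewrite /= in xa ay *.
  have yx : y - x != 0 by rewrite gt_eqF//; lra.
  (* The weight for which the mixture of [x] and [y] is [a]. *)
  pose l := (y - a) / (y - x).
  have lE : l * (y - x) = y - a by rewrite /l; field.
  have il : in01 l by rewrite /in01; apply/andP; split; nra.
  have := cphi _ _ _ hx hy il.
  have -> : l * x + (1 - l) * y = a by nra.
  by nra.
by exists al => x /hal /= ; lra.
Qed.

(** First [alpha] supports the slice at height [b], then [supporting_slope] finds [beta] for the
    remaining gap. Its compatibility condition holds because a segment joining points on either side
    of height [b] crosses the slice, where the first bound combines with convexity. *)
Lemma convex_square_supporting_plane (F : R -> R -> R) (a b : R) :
  convex_on_square F -> 0 < a < 1 -> 0 < b < 1 ->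
  exists alpha beta, forall x y, in01 x -> in01 y ->
    F a b + alpha * (x - a) + beta * (y - b) <= F x y.
Proof.
move=> cF a01 /andP[b0 b1].
have i0 : in01 (0 : R) by rewrite /in01 lexx ler01.
have i1 : in01 (1 : R) by rewrite /in01 lexx ler01.
have ib : in01 b by rewrite /in01 !ltW.
have [|al hal] := @convex_supporting_line (F ^~ b) a _ a01.
  move=> x y t hx hy ht /=; have := cF _ _ _ _ _ hx ib hy ib ht.
  by rewrite (_ : t * b + _ = b)//; ring.
have [||[x y] [/= hx hy] /= ->||be hbe] := @supporting_slope R (R * R)%type
  [set z | in01 z.1 /\ in01 z.2] snd (fun z => F z.1 z.2 - F a b - al * (z.1 - a)) b.
- by exists (0, 0).
- by exists (1, 1).
- by have := hal _ hx; rewrite /=; lra.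
- move=> [x1 y1] [x2 y2] [/= hx1 hy1] [/= hx2 hy2] y1b by2.
  have yx : y2 - y1 != 0 by rewrite gt_eqF//; lra.
  pose l := (y2 - b) / (y2 - y1).
  have lE : l * (y2 - y1) = y2 - b by rewrite /l; field.
  have il : in01 l by rewrite /in01; apply/andP; split; nra.
  have := cF _ _ _ _ _ hx1 hy1 hx2 hy2 il.
  have -> : l * y1 + (1 - l) * y2 = b by nra.
  have := hal _ (in01_conv _ _ _ _ hx1 hx2 il).
  move=> h1 h2.
  have {h1 h2} h : F a b + al * (l * x1 + (1 - l) * x2 - a) <=
    l * F x1 y1 + (1 - l) * F x2 y2 by exact: le_trans h1 h2.
  have -> : b - y1 = (y2 - y1) * (1 - l) by rewrite mulrBr mulr1 mulrC lE; ring.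
  rewrite -lE; set g1 := F x1 y1 in h *; set g2 := F x2 y2 in h *.
  set c := F a b in h *; set G := (X in 0 <= X).
  have -> : G = (y2 - y1) * (l * g1 + (1 - l) * g2 -
    (c + al * (l * x1 + (1 - l) * x2 - a))) by rewrite /G; ring.
  by apply: mulr_ge0; lra.
by exists al, be => x y hx hy; have := hbe (x, y) (conj hx hy); rewrite /=; lra.
Qed.

End Supporting.

(** * Expectations under a density *)

Section DensityExpectation.
Context {R : realType} {dH : measure_display} {H : measurableType dH}.
Variables (mu : {measure set H -> \bar R}) (q : H -> R).
Hypothesis q_dens : is_density mu q.

(** A class of functions integrable against any density, even when [mu] is infinite. *)
Definition bounded_measurable (g : H -> R) : Prop :=
  measurable_fun setT g /\ exists K, forall f, `|g f| <= K.

Lemma bounded_measurable_cst (k : R) : bounded_measurable (fun=> k).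
Proof. by split; [exact: measurable_cst|exists `|k|]. Qed.

Lemma bounded_measurableD (g1 g2 : H -> R) : bounded_measurable g1 ->
  bounded_measurable g2 -> bounded_measurable (fun f => g1 f + g2 f).
Proof.
move=> [m1 [K1 h1]] [m2 [K2 h2]]; split; first exact: measurable_funD.
by exists (K1 + K2) => f; rewrite (le_trans (ler_normD _ _))// lerD.
Qed.

Lemma bounded_measurableZ (k : R) (g : H -> R) : bounded_measurable g ->
  bounded_measurable (fun f => k * g f).
Proof.
move=> [m1 [K h]]; split; first by apply: measurable_funM.
by exists (`|k| * K) => f; rewrite normrM ler_wpM2l.
Qed.

Lemma bounded_measurable01 (U : H -> R) : measurable_fun setT U ->
  (forall f, in01 (U f)) -> bounded_measurable U.
Proof.
move=> mU hU; split=> //; exists 1 => f.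
by have /andP[? ?] := hU f; rewrite ger0_norm.
Qed.

Lemma density_integrable : mu.-integrable setT (EFin \o q).
Proof.
have [mq [q0 q1]] := q_dens; apply/integrableP; split.
  exact/measurable_EFinP.
rewrite (eq_integral (fun f => (q f)%:E)) ?q1 ?ltry// => f _ /=.
by rewrite ger0_norm.
Qed.

Lemma gibbs_integrable (g : H -> R) : bounded_measurable g ->
  mu.-integrable setT (EFin \o (fun f => q f * g f)).
Proof.
move=> [mg [K hK]]; have [mq [q0 _]] := q_dens.
apply: (@le_integrable _ _ _ _ _ measurableT _ (fun f => K%:E * (EFin \o q) f)%E).
- exact/measurable_EFinP/measurable_funM.
- move=> f _ /=; rewrite lee_fin !normrM mulrC ler_wpM2r//.
  exact: le_trans (hK f) (ler_norm _).
- exact/integrableZl/density_integrable.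
Qed.

Lemma gibbs_cst (k : R) : gibbs_risk mu q (fun=> k) = k.
Proof.
rewrite /gibbs_risk RintegralZr//; last exact: density_integrable.
by rewrite /Rintegral; have [_ [_ ->]] := q_dens; rewrite mul1r.
Qed.

Lemma gibbsD (g1 g2 : H -> R) : bounded_measurable g1 -> bounded_measurable g2 ->
  gibbs_risk mu q (fun f => g1 f + g2 f) = gibbs_risk mu q g1 + gibbs_risk mu q g2.
Proof.
move=> b1 b2; rewrite /gibbs_risk -RintegralD//; try exact: gibbs_integrable.
by apply: eq_Rintegral => f _; rewrite mulrDr.
Qed.

Lemma gibbsZ (k : R) (g : H -> R) : bounded_measurable g ->
  gibbs_risk mu q (fun f => k * g f) = k * gibbs_risk mu q g.
Proof.
move=> b; rewrite /gibbs_risk -RintegralZl//; last exact: gibbs_integrable.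
by apply: eq_Rintegral => f _; rewrite mulrCA.
Qed.

Lemma gibbs_le (g1 g2 : H -> R) : bounded_measurable g1 -> bounded_measurable g2 ->
  (forall f, g1 f <= g2 f) -> gibbs_risk mu q g1 <= gibbs_risk mu q g2.
Proof.
move=> b1 b2 h; apply: le_Rintegral => //; try exact: gibbs_integrable.
by move=> f _; rewrite ler_wpM2l//; have [_ []] := q_dens.
Qed.

Lemma gibbs_in01 (U : H -> R) : measurable_fun setT U -> (forall f, in01 (U f)) ->
  in01 (gibbs_risk mu q U).
Proof.
move=> mU hU.
have bU := bounded_measurable01 _ mU hU.
have /= := gibbs_le _ _ (bounded_measurable_cst 0) bU.
have /= := gibbs_le _ _ bU (bounded_measurable_cst 1).
rewrite !gibbs_cst => h1 h0; apply/andP.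
by split; [apply: h0|apply: h1] => f; have /andP[] := hU f.
Qed.

(** The nonnegative function [q * U] has zero integral, so it vanishes almost everywhere; there
    either [q f = 0] or [U f = 0], and [q * g1 = q * g2] in both cases. *)
Lemma gibbs_eq0_eq (U g1 g2 : H -> R) : bounded_measurable U ->
  bounded_measurable g1 -> bounded_measurable g2 -> (forall f, 0 <= U f) ->
  gibbs_risk mu q U = 0 -> (forall f, U f = 0 -> g1 f = g2 f) ->
  gibbs_risk mu q g1 = gibbs_risk mu q g2.
Proof.
move=> bU b1 b2 U0 EU g12; have [mq [q0 _]] := q_dens.
have iU := gibbs_integrable _ bU.
have mU : measurable_fun setT (fun f => (q f * U f)%:E).
  by apply/measurable_EFinP/measurable_funM => //; case: bU.
have I0 : (\int[mu]_f `|(q f * U f)%:E| = 0)%E.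
  rewrite (eq_integral (fun f => (q f * U f)%:E)); last first.
    by move=> f _ /=; rewrite ger0_norm// mulr_ge0.
  rewrite -[LHS]fineK; last exact: (integrable_fin_num _ iU).
  by congr EFin.
have [/(_ I0) ae0 _] := ae_eq_integral_abs mu measurableT mU.
congr fine; apply: ae_eq_integral => //.
- by apply/measurable_EFinP/measurable_funM => //; case: b1.
- by apply/measurable_EFinP/measurable_funM => //; case: b2.
apply: filterS ae0 => f /(_ I) /= [] /eqP; rewrite mulf_eq0 => /orP[/eqP ->|/eqP h] _.
  by rewrite !mul0r.
by rewrite g12.
Qed.

(** The affine minorant has expectation exactly [k], its linear terms being centred at the means.
    This turns a supporting line or plane into Jensen's inequality. *)
Lemma gibbs_affine_le (U V g : H -> R) (k al be : R) :
  bounded_measurable U -> bounded_measurable V -> bounded_measurable g ->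
  (forall f, k + al * (U f - gibbs_risk mu q U) + be * (V f - gibbs_risk mu q V) <= g f) ->
  k <= gibbs_risk mu q g.
Proof.
move=> bU bV bg; set a := gibbs_risk mu q U; set b := gibbs_risk mu q V => h.
have bU' := bounded_measurableZ al _ bU; have bV' := bounded_measurableZ be _ bV.
have bk := bounded_measurable_cst (k - al * a - be * b).
have -> : k = gibbs_risk mu q (fun f => (k - al * a - be * b) + (al * U f + be * V f)).
  rewrite gibbsD//; last exact: bounded_measurableD.
  by rewrite gibbs_cst gibbsD// !gibbsZ// -/a -/b; ring.
apply: gibbs_le => //; first by do 2 (apply: bounded_measurableD => //).
by move=> f; have := h f; lra.
Qed.

(** A function into [0,1] with mean 0 or 1 is almost surely constant under [q]; this is phrased as
    an exchange of integrands so that it can serve for rewriting. *)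
Lemma gibbs_degenerate (U : H -> R) : measurable_fun setT U ->
  (forall f, in01 (U f)) -> 0 < gibbs_risk mu q U < 1 \/
  forall g1 g2, bounded_measurable g1 -> bounded_measurable g2 ->
    (forall f, U f = gibbs_risk mu q U -> g1 f = g2 f) ->
    gibbs_risk mu q g1 = gibbs_risk mu q g2.
Proof.
move=> mU hU; have bU := bounded_measurable01 _ mU hU.
have /andP[] := gibbs_in01 _ mU hU.
rewrite le_eqVlt => /predU1P[a0 _|a0].
  right=> g1 g2 b1 b2 h; apply: (gibbs_eq0_eq _ _ _ bU) => //; last by rewrite -a0 in h.
  by move=> f; have /andP[] := hU f.
rewrite le_eqVlt => /predU1P[a1|a1]; last by left; rewrite a0.
right=> g1 g2 b1 b2 h.
(* When the mean is 1, the vanishing argument applies to [1 - U], whose mean is 0. *)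
have bV : bounded_measurable (fun f => 1 + (- 1) * U f).
  by apply: bounded_measurableD; [exact: bounded_measurable_cst|exact: bounded_measurableZ].
apply: (gibbs_eq0_eq _ _ _ bV) => //.
- by move=> f; have /andP[] := hU f; lra.
- rewrite gibbsD//; [|exact: bounded_measurable_cst|exact: bounded_measurableZ].
  by rewrite gibbs_cst gibbsZ// a1; ring.
- by move=> f f0; apply: h; rewrite a1; lra.
Qed.

(** * Jensen's inequality on the square *)

Section Jensen.
Variables (F : R -> R -> R) (B : R).
Hypotheses (F_convex : convex_on_square F)
  (F_bounded : forall x y, in01 x -> in01 y -> `|F x y| <= B).

Lemma bounded_measurable_convex (u v : H -> R) :
  measurable_fun setT u -> measurable_fun setT v ->
  (forall f, in01 (u f)) -> (forall f, in01 (v f)) ->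
  bounded_measurable (fun f => F (u f) (v f)).
Proof.
move=> mu' mv hu hv; split; first exact: measurable_convex_square.
by exists B => f; exact: F_bounded.
Qed.

(* When a coordinate of the mean is an endpoint of [0,1], that coordinate is
   almost surely constant, so the support plane is only needed at interior
   means; this matters because [F] may be discontinuous at the boundary. *)
Lemma gibbs_jensen (U V : H -> R) :
  measurable_fun setT U -> measurable_fun setT V ->
  (forall f, in01 (U f)) -> (forall f, in01 (V f)) ->
  F (gibbs_risk mu q U) (gibbs_risk mu q V) <= gibbs_risk mu q (fun f => F (U f) (V f)).
Proof.
move=> mU mV hU hV.
have bU := bounded_measurable01 _ mU hU; have bV := bounded_measurable01 _ mV hV.
have ia := gibbs_in01 _ mU hU; have ib := gibbs_in01 _ mV hV.
have bF := bounded_measurable_convex _ _ mU mV hU hV.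
have mc (k : R) : measurable_fun setT (fun _ : H => k) by exact: measurable_cst.
case: (gibbs_degenerate _ mU hU) => [a01|degU];
  case: (gibbs_degenerate _ mV hV) => [b01|degV].
- have [al [be h]] := convex_square_supporting_plane _ _ _ _ F_convex a01 b01.
  by apply: (gibbs_affine_le U V _ _ al be) => // f; apply: h.
- rewrite (degV (fun f => F (U f) (V f)) (fun f => F (U f) (gibbs_risk mu q V)))//; last 2 first.
    by apply: bounded_measurable_convex.
    by move=> f /= ->.
  have [|al h] := @convex_supporting_line R (F ^~ (gibbs_risk mu q V)) _ _ a01.
    move=> x y t hx hy ht; have := F_convex _ _ _ _ _ hx ib hy ib ht.
    by rewrite (_ : t * gibbs_risk mu q V + _ = gibbs_risk mu q V)//; ring.
  apply: (gibbs_affine_le U V _ _ al 0) => //.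
    by apply: bounded_measurable_convex.
  by move=> f; rewrite mul0r addr0; apply: h.
- rewrite (degU (fun f => F (U f) (V f)) (fun f => F (gibbs_risk mu q U) (V f)))//; last 2 first.
    by apply: bounded_measurable_convex.
    by move=> f /= ->.
  have [|be h] := @convex_supporting_line R (F (gibbs_risk mu q U)) _ _ b01.
    move=> x y t hx hy ht; have := F_convex _ _ _ _ _ ia hx ia hy ht.
    by rewrite (_ : t * gibbs_risk mu q U + _ = gibbs_risk mu q U)//; ring.
  apply: (gibbs_affine_le U V _ _ 0 be) => //.
    by apply: bounded_measurable_convex.
  by move=> f; rewrite mul0r addr0; apply: h.
- rewrite (degU (fun f => F (U f) (V f)) (fun f => F (gibbs_risk mu q U) (V f)))//; last 2 first.
    by apply: bounded_measurable_convex.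
    by move=> f /= ->.
  rewrite (degV (fun f => F (gibbs_risk mu q U) (V f))
    (fun f => F (gibbs_risk mu q U) (gibbs_risk mu q V)))//.
  - by rewrite gibbs_cst.
  - by apply: bounded_measurable_convex.
  - exact: bounded_measurable_cst.
  - by move=> f ->.
Qed.

End Jensen.

(** The supporting line is the tangent to the exponential at the mean, from [1 + x <= expR x]. *)
Lemma expR_gibbs_le (g : H -> R) : bounded_measurable g ->
  bounded_measurable (fun f => expR (g f)) ->
  expR (gibbs_risk mu q g) <= gibbs_risk mu q (fun f => expR (g f)).
Proof.
move=> bg be; set a := gibbs_risk mu q g.
apply: (gibbs_affine_le g g _ _ (expR a) 0) => // f.
rewrite mul0r addr0 -/a -[in leRHS](subrK a (g f)) expRD.
by have := expR_ge1Dx (g f - a); have := expR_gt0 a; nra.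
Qed.

(** Tonelli measurability of a parameter integral. It serves for the prior average as a function of
    the sample and, with density 1 against [D], for the true loss as a function of the voter. *)
Lemma integral_density_fubini_measurable (d : measure_display) (T : measurableType d)
    (G : T * H -> R) : measurable_fun setT G -> (forall z, 0 <= G z) ->
  measurable_fun setT (fun w => \int[mu]_f (q f * G (w, f))%:E)%E.
Proof.
move=> mG G0; have [mq [q0 q1]] := q_dens.
pose D := [set f | 0 < q f].
have mgt (r : R) : measurable [set f | r < q f] by exact: measurable_gt_set.
have mD : measurable D := mgt 0.
(* [mu] need not be sigma-finite, but its restriction to [q > 0] is. *)
have sfin : sigma_finite setT (mrestr mu mD).
  (* As [q] integrates to 1, Markov's inequality gives each set [q > 1/(n+1)] finite measure; the
     complement of [D] completes the cover and is null for the restricted measure. *)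
  exists (fun n => [set f | n.+1%:R^-1 < q f] `|` ~` D).
    apply/seteqP; split => // f _.
    have [qf|qf] := ltP 0 (q f); last first.
      by exists 0%N => //; right; rewrite /D /= ltNge qf.
    have [n _ /= nq] := near_infty_natSinv_lt (PosNum qf).
    by exists n => //; left; apply: nq => /=.
  move=> n; split; first by apply: measurableU => //; exact: measurableC.
  rewrite /mrestr setIUl setICl setU0 setIidl; last first.
    by move=> f /=; apply: le_lt_trans; rewrite invr_ge0.
  have n0 : 0 < n.+1%:R^-1 :> R by rewrite invr_gt0.
  have mq' : measurable_fun setT (EFin \o q) by exact/measurable_EFinP.
  have := le_integral_abse mu measurableT mq' n0.
  rewrite (eq_integral (fun f => (q f)%:E)) ?q1; last first.
    by move=> f _ /=; rewrite ger0_norm.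
  rewrite setTI => h.
  have h2 : (mu [set f | (n.+1%:R^-1%:E <= `|(EFin \o q) f|)%E] < +oo)%E.
    rewrite ltey; apply: contraTneq h => ->.
    by rewrite mulry gtr0_sg// mul1e.
  apply: le_lt_trans h2; apply: le_measure.
  - by rewrite inE.
  - rewrite inE -[X in measurable X]setTI.
    by apply: emeasurable_fun_c_infty => //; exact: measurableT_comp.
  - by move=> f /= /ltW h3; rewrite lee_fin ger0_norm.
pose nu : {sigma_finite_measure set H -> \bar R} :=
  HB.pack (mrestr mu mD) (Measure_isSigmaFinite.Build _ _ _ (mrestr mu mD) sfin).
pose G' (z : T * H) := (q z.2 * G z)%:E.
have mG' : measurable_fun setT G'.
  apply/measurable_EFinP/measurable_funM => //.
  exact: measurableT_comp mq measurable_snd.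
have G'0 z : (0 <= G' z)%E by rewrite lee_fin mulr_ge0.
have := @measurable_fun_fubini_tonelli_F _ _ T H R nu G' mG' G'0.
congr measurable_fun; apply/funext => w; rewrite /fubini_F.
(* Off [D] the density is 0, so restricting the measure leaves the integral unchanged. *)
have E : (fun f => G' (w, f)) \_ D = (fun f => G' (w, f)).
  apply/funext => f; rewrite patchE; case: ifPn => //.
  rewrite notin_setE /D /G' /= => /negP; rewrite -leNgt => qf.
  by rewrite (_ : q f = 0) ?mul0r//; apply/le_anti; rewrite qf q0.
rewrite -E -integral_mkcond.
transitivity (\int[mu]_(f in D) G' (w, f))%E; last first.
  by rewrite integral_mkcond E.
apply: eq_measure_integral => A mA AD /=.
by rewrite /mrestr setIidl.
Qed.

End DensityExpectation.

(** * Invariance under complementation and the change of measure *)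

Section Alignment.
Context {R : realType} {dH : measure_display} {H : measurableType dH}.
Variables (mu : {measure set H -> \bar R}) (c : H -> H).
Hypotheses (c_meas : measurable_fun setT c)
  (mu_inv : forall A, measurable A -> mu (c @^-1` A) = mu A).

Lemma invariant_integral (g : H -> \bar R) : measurable_fun setT g ->
  (forall f, 0 <= g f)%E -> (\int[mu]_f g (c f) = \int[mu]_f g f)%E.
Proof.
move=> mg g0.
have := @ge0_integral_pushforward _ _ _ _ _ c c_meas mu setT g measurableT mg
  (fun f _ => g0 f).
rewrite preimage_setT => <-.
by apply: eq_measure_integral => A mA _ /=; rewrite /pushforward mu_inv.
Qed.

Lemma density_comp (q : H -> R) : is_density mu q -> is_density mu (q \o c).
Proof.
move=> [mq [q0 q1]]; split; first exact: measurableT_comp.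
split=> [f|]; first exact: q0.
by rewrite -q1 -(invariant_integral (EFin \o q))//; exact/measurable_EFinP.
Qed.

Lemma gibbs_comp (q g : H -> R) : is_density mu q -> bounded_measurable g ->
  (forall f, g (c f) = g f) ->
  gibbs_risk mu (q \o c) g = gibbs_risk mu q g.
Proof.
move=> dq bg gc; have [mq [q0 _]] := dq.
have [mg [K hK]] := bg.
have bK := bounded_measurable_cst (H := H) K.
have dqc := density_comp _ dq.
have bgK := bounded_measurableD _ _ bg bK.
(* Adding [K] makes the integrand nonnegative, as [invariant_integral] requires; both densities have
   mass 1, so the constant cancels. *)
suff: gibbs_risk mu (q \o c) (fun f => g f + K) = gibbs_risk mu q (fun f => g f + K).
  by rewrite !gibbsD// !gibbs_cst// => /addIr.
congr fine; rewrite -(invariant_integral (fun f => (q f * (g f + K))%:E)).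
- by apply: eq_integral => f _; rewrite /= gc.
- by apply/measurable_EFinP/measurable_funM => //; case: bgK.
- move=> f; rewrite lee_fin mulr_ge0//.
  by have := hK f; rewrite ler_norml => /andP[]; lra.
Qed.

(** For a [c]-invariant [g], the densities [q] and [q \o c] give the same expectation, so twice that
    expectation is the integral of [g] against their sum, and alignment equates this sum with the
    one for [p]. *)
Lemma gibbs_aligned (p q g : H -> R) : is_density mu p -> is_density mu q ->
  aligned c q p -> bounded_measurable g -> (forall f, g (c f) = g f) ->
  gibbs_risk mu q g = gibbs_risk mu p g.
Proof.
move=> dp dq al bg gc.
have sumE (r : H -> R) : is_density mu r ->
    Rintegral mu setT (fun f => (r f + r (c f)) * g f) = 2 * gibbs_risk mu r g.
  move=> dr; have dr' := density_comp _ dr.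
  rewrite mulr2n mulrDl mul1r -{2}(gibbs_comp _ _ dr bg gc) /gibbs_risk.
  rewrite -RintegralD//; try exact: gibbs_integrable.
  by apply: eq_Rintegral => f _; rewrite mulrDl.
have : Rintegral mu setT (fun f => (q f + q (c f)) * g f) =
    Rintegral mu setT (fun f => (p f + p (c f)) * g f).
  by apply: eq_Rintegral => f _; rewrite al.
by rewrite !sumE// => /mulfI; apply; rewrite pnatr_eq0.
Qed.

End Alignment.

(** * Markov's inequality *)

Section Probability.
Context {R : realType} {d : measure_display} {T : measurableType d}.
Variable P : probability T R.

(** Seen as density 1 against itself, a probability inherits all the expectation lemmas above; this
    is used for both [Pr] and [D]. *)
Lemma is_density1 : is_density P (fun=> 1 : R).
Proof.
split; first exact: measurable_cst.
by split=> //; rewrite integral_cst// mul1e; exact: probability_setT.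
Qed.

Lemma gibbs1 (g : T -> R) : gibbs_risk P (fun=> 1) g = Rintegral P setT g.
Proof. by apply: eq_Rintegral => t _; rewrite mul1r. Qed.

Lemma markov_le (y : T -> R) (delta : R) : 0 < delta ->
  bounded_measurable y -> (forall t, 0 <= y t) -> 0 < Rintegral P setT y ->
  measurable [set t | y t <= delta^-1 * Rintegral P setT y] /\
  ((1 - delta)%:E <= P [set t | (y t <= delta^-1 * Rintegral P setT y)%R])%E.
Proof.
move=> d0 by_ y0; set I := Rintegral P setT y => I0; have [my _] := by_.
set a := delta^-1 * I; have a0 : 0 < a by rewrite mulr_gt0// invr_gt0.
have mA : measurable [set t | y t <= a].
  have := my measurableT _ (measurable_itv `]-oo, a]).
  by rewrite setTI; congr measurable; apply/seteqP; split => s /=; rewrite in_itv/=.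
split=> //.
have iy : P.-integrable setT (EFin \o y).
  have := gibbs_integrable P _ is_density1 _ by_; congr (_.-integrable _ _).
  by apply/funext => t /=; rewrite mul1r.
have my' : measurable_fun setT (EFin \o y) by exact/measurable_EFinP.
have mB : measurable [set t | (a%:E <= `|(EFin \o y) t|)%E].
  rewrite -[X in measurable X]setTI.
  by apply: emeasurable_fun_c_infty => //; exact: measurableT_comp.
have hB : a * fine (P [set t | (a%:E <= `|(EFin \o y) t|)%E]) <= I.
  rewrite -lee_fin EFinM !fineK ?fin_num_measure//; last first.
    exact: integrable_fin_num iy.
  have := le_integral_abse P measurableT my' a0.
  rewrite setTI (eq_integral (EFin \o y))// => t _ /=.
  by rewrite ger0_norm.
(* The complement of the event is a strict superlevel set, contained in the closed one that Markov's
   inequality controls. *)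
have PB : (P (~` [set t | (y t <= a)%R]) <= P [set t | (a%:E <= `|(EFin \o y) t|)%E])%E.
  apply: le_measure; rewrite ?inE//; first exact: measurableC.
  by move=> t /= /negP; rewrite -ltNge => /ltW ay; rewrite lee_fin ger0_norm.
have := probability_setC P mA; move: PB => /[swap] ->.
rewrite -(fineK (fin_num_measure P _ mA)) -(fineK (fin_num_measure P _ mB)).
rewrite -EFinB !lee_fin; move: hB; set b := fine _; set x := fine _ => hB hx.
suff : b <= delta by lra.
rewrite -(ler_pM2l a0); apply: le_trans hB _.
by rewrite /a mulrAC mulVf ?mul1r// gt_eqF.
Qed.

End Probability.

(** * Range, complementation and measurability of the losses *)

Section Losses.
Context {R : realType} {dX : measure_display} {X : measurableType dX}.

Lemma lin_loss_in01 (a : R) (y : bool) : -1 <= a <= 1 -> in01 (lin_loss a y).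
Proof. by rewrite /in01 /lin_loss /lab; case: y; lra. Qed.

Lemma lin_lossN (a : R) (y : bool) : lin_loss (- a) y = 1 - lin_loss a y.
Proof. by rewrite /lin_loss; field. Qed.

Lemma measurable_lin_loss (d : measure_display) (T : measurableType d)
    (u : T -> R) (y : T -> bool) : measurable_fun setT u -> measurable_fun setT y ->
  measurable_fun setT (fun t => lin_loss (u t) (y t)).
Proof.
move=> mu my; apply: measurable_funM => //; apply: measurable_funB => //.
by apply: measurable_funM => //; apply: measurable_fun_ifT.
Qed.

Lemma emp_loss_in01 (m : nat) (S : 'I_m -> (X * bool)%type) (f : X -> R) :
  (0 < m)%N -> (forall x, -1 <= f x <= 1) -> in01 (emp_loss S f).
Proof.
move=> m0 hf; have m0' : 0 < m%:R :> R by rewrite ltr0n.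
rewrite /in01 /emp_loss; apply/andP; split.
  apply: mulr_ge0; first by rewrite invr_ge0 ltW.
  apply: sumr_ge0 => i _.
  by have /andP[] := lin_loss_in01 _ (S i).2 (hf (S i).1).
rewrite ler_pdivrMl// mulr1 -[X in _ <= X%:R](card_ord m) -sumr_const ler_sum// => i _.
by have /andP[] := lin_loss_in01 _ (S i).2 (hf (S i).1).
Qed.

(** The [m] summands 1 average to 1 because [m] is positive; at [m = 0] the convention [0^-1 = 0]
    would make both empirical losses 0. *)
Lemma emp_lossN (m : nat) (S : 'I_m -> (X * bool)%type) (f : X -> R) :
  (0 < m)%N -> emp_loss S (fun x => - f x) = 1 - emp_loss S f.
Proof.
move=> m0; have m0' : m%:R != 0 :> R by rewrite pnatr_eq0 -lt0n.
rewrite /emp_loss; under eq_bigr do rewrite lin_lossN.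
by rewrite sumrB sumr_const card_ord mulrBr mulVf.
Qed.

Variable D : probability (X * bool)%type R.

Lemma measurable_voter_loss (f : X -> R) : measurable_fun setT f ->
  measurable_fun setT (fun z : X * bool => lin_loss (f z.1) z.2).
Proof.
by move=> mf; apply: measurable_lin_loss => //; exact: measurableT_comp.
Qed.

Lemma true_loss_in01 (f : X -> R) : measurable_fun setT f ->
  (forall x, -1 <= f x <= 1) -> in01 (true_loss D f).
Proof.
move=> mf hf; rewrite /true_loss -gibbs1.
apply: gibbs_in01; first exact: is_density1.
  exact: measurable_voter_loss.
by move=> z; exact: lin_loss_in01.
Qed.

Lemma true_lossN (f : X -> R) : measurable_fun setT f ->
  (forall x, -1 <= f x <= 1) -> true_loss D (fun x => - f x) = 1 - true_loss D f.
Proof.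
move=> mf hf; have d1 := is_density1 D.
have bl : bounded_measurable (fun z : X * bool => lin_loss (f z.1) z.2).
  apply: bounded_measurable01; first exact: measurable_voter_loss.
  by move=> z; exact: lin_loss_in01.
rewrite /true_loss -!gibbs1.
have -> : (fun z : X * bool => lin_loss (- f z.1) z.2) =
    (fun z => 1 + (- 1) * lin_loss (f z.1) z.2).
  by apply/funext => z; rewrite lin_lossN; ring.
rewrite gibbsD//; [|exact: bounded_measurable_cst|exact: bounded_measurableZ].
by rewrite gibbs_cst// gibbsZ//; ring.
Qed.

Context {dH : measure_display} {H : measurableType dH}.
Variable h : H -> X -> R.
Hypotheses (h_meas : measurable_fun setT (fun fx : H * X => h fx.1 fx.2))
  (h_range : forall f x, -1 <= h f x <= 1).

Lemma measurable_true_loss : measurable_fun setT (fun f => true_loss D (h f)).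
Proof.
have mG : measurable_fun setT
    (fun z : H * (X * bool) => lin_loss (h z.1 z.2.1) z.2.2).
  apply: measurable_lin_loss.
    apply: (@measurableT_comp _ _ _ _ _ _ _ _
      (fun z : H * (X * bool) => (z.1, z.2.1)) h_meas).
    apply/measurable_fun_pairP; split; first exact: measurable_fst.
    exact: measurableT_comp measurable_fst measurable_snd.
  exact: measurableT_comp measurable_snd measurable_snd.
have G0 (z : H * (X * bool)) : 0 <= lin_loss (h z.1 z.2.1) z.2.2.
  by have /andP[] := lin_loss_in01 _ z.2.2 (h_range z.1 z.2.1).
have := integral_density_fubini_measurable _ _ (is_density1 D) _ _ _ mG G0.
move=> mI; rewrite /true_loss /Rintegral; apply: measurableT_comp => //.
by move: mI; congr measurable_fun; apply/funext => f; apply: eq_integral => z _; rewrite mul1r.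
Qed.

Lemma measurable_emp_loss (m : nat) (dO : measure_display) (Omega : measurableType dO)
    (Z : 'I_m -> Omega -> (X * bool)%type) :
  (forall i, measurable_fun setT (Z i)) ->
  measurable_fun setT (fun z : Omega * H => emp_loss (fun i => Z i z.1) (h z.2)).
Proof.
move=> mZ; apply: measurable_funM => //; apply: measurable_sum => i.
have mZi : measurable_fun setT (fun z : Omega * H => Z i z.1).
  exact: measurableT_comp (mZ i) measurable_fst.
apply: measurable_lin_loss; last exact: measurableT_comp measurable_snd mZi.
apply: (@measurableT_comp _ _ _ _ _ _ _ _
  (fun z : Omega * H => (z.2, (Z i z.1).1)) h_meas).
apply/measurable_fun_pairP; split; first exact: measurable_snd.
exact: measurableT_comp measurable_fst mZi.
Qed.

End Losses.

Lemma symmetric_convex_bounded (R : realType) (F : R -> R -> R) :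
  convex_on_square F ->
  (forall q r, in01 q -> in01 r -> F q r = F (1 - q) (1 - r)) ->
  exists B, forall x y, in01 x -> in01 y -> `|F x y| <= B.
Proof.
move=> cF sF; have [M FM] := convex_square_ubound _ _ cF.
(* By symmetry the centre of the square is a minimum. *)
have Fc x y : in01 x -> in01 y -> F 2^-1 2^-1 <= F x y.
  move=> hx hy.
  have hx' : in01 (1 - x) by move: hx; rewrite /in01; lra.
  have hy' : in01 (1 - y) by move: hy; rewrite /in01; lra.
  have h2 : in01 (2^-1 : R) by rewrite /in01; lra.
  have := cF _ _ _ _ _ hx hy hx' hy' h2.
  rewrite -(sF x y)// (_ : 2^-1 * x + _ = 2^-1); last by field.
  by rewrite (_ : 2^-1 * y + _ = 2^-1); [lra|field].
exists (`|M| + `|F 2^-1 2^-1|) => x y hx hy.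
have := FM _ _ hx hy; have := Fc _ _ hx hy.
have := ler_norm M; have := ler_norm (- F 2^-1 2^-1); rewrite normrN.
have := normr_ge0 M; have := normr_ge0 (F 2^-1 2^-1).
by rewrite ler_norml; lra.
Qed.

(** * Assembly of the bound *)

Theorem mainTheorem13
  (R : realType)
  (* the data distribution D on X x {-1,1} *)
  (dX : measure_display) (X : measurableType dX) (D : probability (X * bool)%type R)
  (* the sample S ~ D^m : m i.i.d. draws Z_0..Z_{m-1} on a probability space *)
  (m : nat) (m_gt0 : (0 < m)%N)
  (dO : measure_display) (Omega : measurableType dO) (Pr : probability Omega R)
  (Z : 'I_m -> Omega -> (X * bool)%type)
  (Z_meas : forall i, measurable_fun setT (Z i))
  (Z_indep : mutually_independent Pr Z)
  (Z_law : forall i, has_law Pr (Z i) D)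
  (* the self-complemented set of voters H, indexed by a measurable space,
     with a reference measure mu invariant under the complement map c *)
  (dH : measure_display) (H : measurableType dH) (mu : {measure set H -> \bar R})
  (h : H -> X -> R)
  (h_inj : injective h)
  (h_meas : measurable_fun setT (fun fx : H * X => h fx.1 fx.2))
  (h_range : forall f x, -1 <= h f x <= 1)
  (c : H -> H) (c_bij : bijective c) (c_meas : measurable_fun setT c)
  (c_compl : forall f, h (c f) = (fun x => - h f x))
  (mu_inv : forall A, measurable A -> mu (c @^-1` A) = mu A)
  (* the prior P, given by its density p *)
  (p : H -> R) (p_dens : is_density mu p)
  (* the comparator function *)
  (Dfun : R -> R -> R)
  (Dfun_convex : convex_on_square Dfun)
  (Dfun_sym : forall q r, in01 q -> in01 r -> Dfun q r = Dfun (1 - q) (1 - r))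
  (m' : R) (m'_gt0 : 0 < m')
  (delta : R) (delta_gt0 : 0 < delta) (delta_le1 : delta <= 1) :
  let S := fun (w : Omega) (i : 'I_m) => Z i w in
  exists A : set Omega, measurable A /\ (Pr A >= (1 - delta)%:E)%E /\
    forall w, A w ->
    forall q : H -> R, is_density mu q -> aligned c q p ->
      ((Dfun (gibbs_risk mu q (fun f => emp_loss (S w) (h f)))
             (gibbs_risk mu q (fun f => true_loss D (h f))))%:E
       <= (m'^-1)%:E *
          lne ((delta^-1)%:E *
               \int[Pr]_w' \int[mu]_f
                  (p f * expR (m' * Dfun (emp_loss (S w') (h f))
                                         (true_loss D (h f))))%:E))%E.
Proof.
move=> S; have [B DB] := symmetric_convex_bounded _ _ Dfun_convex Dfun_sym.
pose U w f := emp_loss (S w) (h f); pose V f := true_loss D (h f).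
have mh f : measurable_fun setT (h f).
  exact: measurableT_comp h_meas (pair1_measurable f).
have hU w f : in01 (U w f) by exact: emp_loss_in01.
have hV f : in01 (V f) by exact: true_loss_in01.
have mUj : measurable_fun setT (fun z : Omega * H => U z.1 z.2).
  exact: measurable_emp_loss.
have mU w : measurable_fun setT (U w).
  exact: measurableT_comp mUj (pair1_measurable w).
have mV : measurable_fun setT V by exact: measurable_true_loss.
pose g w f := Dfun (U w f) (V f).
have bg w : bounded_measurable (g w).
  exact: (bounded_measurable_convex _ _ Dfun_convex DB).
have gB w f : - B <= g w f <= B by rewrite -ler_norml; exact: DB.
pose e w f := expR (m' * g w f).
(* The upper bound gives integrability; the strictly positive lower bound passes to [y] and to its
   mean, so the logarithm is taken at a positive real. *)
have eB w f : expR (- (m' * B)) <= e w f <= expR (m' * B).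
  by rewrite !ler_expR; have := gB w f; nra.
have mej : measurable_fun setT (fun z : Omega * H => e z.1 z.2).
  apply: measurableT_comp => //; apply: measurable_funM => //.
  by apply: measurable_convex_square => //; exact: measurableT_comp mV measurable_snd.
have be w : bounded_measurable (e w).
  split; first exact: measurableT_comp mej (pair1_measurable w).
  exists (expR (m' * B)) => f; rewrite ger0_norm ?expR_ge0//.
  by have /andP[] := eB w f.
pose y w := gibbs_risk mu p (e w).
have yE w : (\int[mu]_f (p f * e w f)%:E = (y w)%:E)%E.
  by rewrite /y /gibbs_risk /Rintegral fineK//; exact: integrable_fin_num (gibbs_integrable _ _ p_dens _ (be w)).
have yl w : expR (- (m' * B)) <= y w.
  rewrite -[leLHS](gibbs_cst _ _ p_dens); apply: gibbs_le => //.
    exact: bounded_measurable_cst.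
  by move=> f; have /andP[] := eB w f.
have yr w : y w <= expR (m' * B).
  rewrite -[leRHS](gibbs_cst _ _ p_dens); apply: gibbs_le => //.
    exact: bounded_measurable_cst.
  by move=> f; have /andP[] := eB w f.
have y0 w : 0 <= y w by apply: le_trans (yl w); exact: expR_ge0.
have by_ : bounded_measurable y.
  split; last by exists (expR (m' * B)) => w; rewrite ger0_norm.
  apply/measurable_EFinP.
  have := integral_density_fubini_measurable _ _ p_dens _ _ _ mej (fun z => expR_ge0 _).
  by congr measurable_fun; apply/funext => w; exact: yE.
have d1 := is_density1 Pr.
have I0 : 0 < Rintegral Pr setT y.
  apply: lt_le_trans (expR_gt0 (- (m' * B))) _.
  rewrite -gibbs1 -[leLHS](gibbs_cst _ _ d1); apply: gibbs_le => //.
  exact: bounded_measurable_cst.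
have [mA PA] := markov_le Pr _ _ delta_gt0 by_ y0 I0.
(* The event involves only the prior, so the bound holds on it for all aligned posteriors at
   once. *)
exists [set w | y w <= delta^-1 * Rintegral Pr setT y]; split=> //; split=> // w /= Aw q q_dens al.
have -> : (\int[Pr]_w' \int[mu]_f (p f * expR (m' * Dfun (emp_loss (S w') (h f))
    (true_loss D (h f))))%:E = (Rintegral Pr setT y)%:E)%E.
  rewrite /Rintegral fineK; first by apply: eq_integral => w' _; exact: yE.
  have := gibbs_integrable _ _ d1 _ by_ => /(integrable_fin_num measurableT).
  by congr (_ \is a fin_num); apply: eq_integral => w' _ /=; rewrite mul1r.
have a0 : 0 < delta^-1 * Rintegral Pr setT y by rewrite mulr_gt0// invr_gt0.
rewrite -EFinM lne_EFin// -EFinM lee_fin.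
have gc f : g w (c f) = g w f.
  rewrite /g /U /V c_compl emp_lossN// true_lossN// -Dfun_sym//; [exact: hU|exact: hV].
apply: (@le_trans _ _ (gibbs_risk mu q (g w))).
  exact: (gibbs_jensen _ _ q_dens _ _ Dfun_convex DB (U w) V (mU w) mV (hU w) hV).
(* The posterior disappears here: what remains is [expR] of [m'] times the prior mean of [g w], to
   be compared with [y w]. *)
rewrite (gibbs_aligned _ _ c_meas mu_inv _ _ _ p_dens)// ler_pdivlMl//.
rewrite -ler_expR lnK ?posrE//; apply: le_trans Aw.
by rewrite -gibbsZ//; apply: (expR_gibbs_le _ _ p_dens _ _ (be w)); exact: bounded_measurableZ.
Qed.
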